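(* Let $N\ge1$ be a natural number, $h=\frac1N$, and let $\mathring\ell$ be the error functional $$(\mathring\ell,\varphi)=\int_0^1\varphi(x)\,dx-\sum_{\beta=0}^N\bigl(C_0[\beta]\varphi(h\beta)+\mathring C_1[\beta]\varphi'(h\beta)\bigr),$$ where $C_0[0]=C_0[N]=\frac h2$, $C_0[\beta]=h$ for $1\le\beta\le N-1$, and $$\mathring C_1[0]=\frac{h(e^h+1)}{2(e^h-1)}-1,\qquad \mathring C_1[\beta]=0\ \ (1\le\beta\le N-1),\qquad \mathring C_1[N]=1-\frac{h(e^h+1)}{2(e^h-1)}.$$ Then $$\bigl\|\mathring\ell|W_2^{(2,1)*}(0,1)\bigr\|^2=-\sum_{n=4}^\infty\frac{B_nh^n}{n!}=\frac1{720}h^4-\frac1{30240}h^6+O(h^8),$$ where $B_n$ are the Bernoulli numbers.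
   Context: $W_2^{(2,1)}(0,1)$ is the class of real functions $\varphi$ on $[0,1]$ having an absolutely continuous first derivative and second derivative in $L_2(0,1)$, with the semi-norm $$\|\varphi|W_2^{(2,1)}(0,1)\|=\Bigl[\int_0^1(\varphi''(x)+\varphi'(x))^2dx\Bigr]^{1/2}$$ (functions differing by a linear combination of $1$ and $e^{-x}$ are identified, which makes it a Hilbert space). For a linear functional $\ell$ on it vanishing at $1$ and $e^{-x}$, $$\|\ell|W_2^{(2,1)*}(0,1)\|=\sup_{\|\varphi|W_2^{(2,1)}(0,1)\|=1}|(\ell,\varphi)|.$$ The Bernoulli numbers are defined by $\frac{x}{e^x-1}=\sum_{n=0}^\infty\frac{B_n}{n!}x^n$, $|x|<2\pi$. The $O(h^8)$ is as $h=1/N\to0$. *)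

(* Defs.v *)
From HB Require Import structures.
From mathcomp Require Import all_boot all_order all_algebra.
From mathcomp Require Import all_classical all_reals all_analysis.

Set Implicit Arguments.
Unset Strict Implicit.
Unset Printing Implicit Defensive.

Import Order.TTheory GRing.Theory Num.Theory.
Import numFieldNormedType.Exports.

Local Open Scope classical_set_scope.
Local Open Scope ring_scope.

(* Functions on [0, 1] are represented by functions R -> R of which only the
   values on [0, 1] are used. *)

Section Derivative.
Context {R : realType}.
Implicit Types (A : set R) (f : R -> R).

Definition diff_quotient f (x : R) : R -> R :=
  fun y => (f y - f x) / (y - x).

(* The limits are relative to A: at an end point of A = [a, b] these are the
   one-sided derivatives, at an interior point the ordinary derivative. *)
Definition derivable_on A f :=
  forall x, A x -> cvg (diff_quotient f x @ within A x^').

Definition derive_on A f (x : R) : R :=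
  lim (diff_quotient f x @ within A x^').

Definition absolutely_continuous_on (a b : R) f :=
  forall e : R, 0 < e -> exists2 d : R, 0 < d &
    forall (n : nat) (s t : 'I_n -> R),
      (forall i, a <= s i /\ s i <= t i /\ t i <= b) ->
      trivIset setT (fun i => `]s i, t i[%classic) ->
      \sum_(i < n) (t i - s i) < d ->
      \sum_(i < n) `|f (t i) - f (s i)| < e.

End Derivative.

Section SobolevSpace.
Context {R : realType}.
Implicit Types (phi : R -> R) (l : (R -> R) -> R).

Local Notation mu := (@lebesgue_measure R).

Definition deriv01 phi : R -> R := derive_on `[0, 1] phi.

Definition deriv2 phi : R -> R := derive1 (deriv01 phi).

(* Absolute continuity of phi' already makes phi'' exist almost everywhere;
   W2_derivable2 records that the values of the total operator derive1 are
   genuine derivatives almost everywhere. *)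
Record W2_class phi : Prop := {
  W2_derivable : derivable_on `[0, 1] phi;
  W2_abs_cont : absolutely_continuous_on 0 1 (deriv01 phi);
  W2_derivable2 :
    {ae mu, forall x : R, x \in `]0, 1[ -> derivable (deriv01 phi) x 1};
  W2_L2 : (deriv2 phi \_ `]0, 1[) \in Lfun mu 2%:E
}.

Definition W2_seminorm phi : R :=
  Num.sqrt (\int[mu]_(x in `]0, 1[) (deriv2 phi x + deriv01 phi x) ^+ 2).

(* The supremum runs over representatives, which is the same as running over
   classes modulo 1 and e^{-x} when l vanishes at these two functions.  It is
   taken in the extended reals, so an unbounded l has norm +oo. *)
Definition W2_dual_norm l : \bar R :=
  ereal_sup [set `|l phi|%:E |
             phi in [set phi | W2_class phi /\ W2_seminorm phi = 1]].

End SobolevSpace.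

Section ErrorFunctional.
Context {R : realType}.

Definition mesh (N : nat) : R := 1 / N%:R.

Definition C0 (N b : nat) : R :=
  if (b == 0%N) || (b == N) then mesh N / 2 else mesh N.

Definition C1 (N b : nat) : R :=
  let h := mesh N in
  let K := h * (expR h + 1) / (2 * (expR h - 1)) in
  if b == 0%N then K - 1 else if b == N then 1 - K else 0.

Definition error_functional (N : nat) (phi : R -> R) : R :=
  \int[lebesgue_measure]_(x in `[0, 1]) phi x
  - \sum_(0 <= b < N.+1) (C0 N b * phi (mesh N * b%:R)
                          + C1 N b * deriv01 phi (mesh N * b%:R)).

(* x = 0 is a removable singularity of x / (e^x - 1), excluded because
   0 / 0 = 0 for the total division; the remaining x determine B. *)
Definition is_bernoulli (B : nat -> R) :=
  forall x : R, x != 0 -> `|x| < 2 * pi ->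
    series (fun n => B n / n`!%:R * x ^+ n) @ \oo --> x / (expR x - 1).

End ErrorFunctional.

(* Main.v *)
Require Import Defs.
From HB Require Import structures.
From mathcomp Require Import all_boot all_order all_algebra.
From mathcomp Require Import all_classical all_reals all_analysis.
From mathcomp Require Import measurable_realfun ring lra.

Import Order.TTheory GRing.Theory Num.Theory.
Import numFieldNormedType.Exports.

Local Open Scope classical_set_scope.
Local Open Scope ring_scope.

(** On a mesh cell [a, a + h] put K(s) = h/2 - 1 - s + h e^s / (e^h - 1).  It
    satisfies K'' - K' = 1, K(0) = K(h) = C1[0], and K - K' is h/2 at s = 0 and
    -h/2 at s = h.  Integrating by parts the absolutely continuous function
    K phi' + (K - K') phi over each cell, whose derivative is
    K (phi'' + phi') - phi, represents the error functional as
    (l, phi) = int_0^1 k (phi'' + phi'), where k is the h-periodic copy of K.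
    Cauchy-Schwarz gives |l|^2 <= int_0^1 k^2, and the bound is attained by the
    solution of phi'' + phi' = k / |k|, which is C^2 because K(0) = K(h).  An
    explicit primitive gives int_0^1 k^2 = 1 - h/2 + h^2/12 - h / (e^h - 1).

    The first eight Bernoulli numbers are read off by comparing Taylor
    polynomials: a power series converging at 2 differs from its partial sum of
    order m by O(x^m) on [0, 1], and a polynomial of degree < m that is O(x^m)
    vanishes. *)

(** * Absolutely continuous functions *)

Section AbsoluteContinuity.
Context {R : realType}.
Implicit Types (f g H : R -> R) (a b c d : R).

Local Notation mu := (@lebesgue_measure R).

Lemma abs_cont_sub a b c d f : a <= c -> d <= b ->
  absolutely_continuous_on a b f -> absolutely_continuous_on c d f.
Proof.
move=> ac db acf e /acf[r r0 rP]; exists r => // n s t st.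
apply: rP => i; have [sl [le tr]] := st i.
by rewrite le (le_trans ac) // (le_trans tr).
Qed.

(** One domination principle serves sums, products and differences. With C = 1 and D = 0 it also
    transfers absolute continuity to a function that agrees with f on [a, b]. *)
Lemma abs_cont_le a b f g (C D : R) :
  absolutely_continuous_on a b f -> absolutely_continuous_on a b g ->
  forall h : R -> R,
  (forall s t, a <= s -> s <= t -> t <= b ->
    `|h t - h s| <= C * `|f t - f s| + D * `|g t - g s|) ->
  absolutely_continuous_on a b h.
Proof.
move=> acf acg h hP e e0.
(* C and D carry no sign hypothesis; the 1 in the maximum keeps the divisor positive. *)
pose M := Num.max 1 (Num.max C D).
have M0 : 0 < M by rewrite lt_max ltr01.
have e2 : 0 < e / 2 / M by rewrite !divr_gt0.
have [r r0 rP] := acf _ e2; have [q q0 qP] := acg _ e2.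
exists (Num.min r q); first by rewrite lt_min r0 q0.
move=> n s t st tri; rewrite lt_min => /andP[ltr ltq].
have := ltrD (rP _ _ _ st tri ltr) (qP _ _ _ st tri ltq).
rewrite -mulrDl -splitr ltr_pdivlMr// mulrDl !mulr_suml -big_split/=.
apply: le_lt_trans; apply: ler_sum => i _.
have [sl [le tr]] := st i.
apply: (le_trans (hP _ _ sl le tr)); apply: lerD; rewrite mulrC ler_wpM2l//.
  by rewrite !le_max lexx orbT.
by rewrite !le_max lexx !orbT.
Qed.

Lemma abs_contD a b f g :
  absolutely_continuous_on a b f -> absolutely_continuous_on a b g ->
  absolutely_continuous_on a b (fun x => f x + g x).
Proof.
move=> acf acg; apply: (abs_cont_le a b f g 1 1 acf acg) => s t _ _ _.
by rewrite !mul1r opprD addrACA ler_normD.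
Qed.

Lemma lipschitz_abs_cont a b f (C : R) :
  (forall s t, a <= s -> s <= t -> t <= b -> `|f t - f s| <= C * (t - s)) ->
  absolutely_continuous_on a b f.
Proof.
move=> lip e e0; pose M := Num.max 1 C.
have M0 : 0 < M by rewrite lt_max ltr01.
exists (e / M); first exact: divr_gt0.
move=> n s t st _; rewrite ltr_pdivlMr// mulr_suml.
apply: le_lt_trans; apply: ler_sum => i _.
have [sl [le tr]] := st i.
apply: (le_trans (lip _ _ sl le tr)).
by rewrite mulrC ler_wpM2l// ?subr_ge0// le_max lexx orbT.
Qed.

Lemma abs_cont_within a b f : absolutely_continuous_on a b f ->
  {within `[a, b], continuous f}.
Proof.
move=> acf; apply/subspace_continuousP => x xab.
apply/cvgrPdist_lt => e e0; have [d d0 dP] := acf _ e0.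
rewrite near_withinE; near=> y => yab.
have xy : `|x - y| < d by near: y; exact: (@near_ball R R x d d0).
have key u v : u \in `[a, b] -> v \in `[a, b] -> u <= v -> `|u - v| < d ->
    `|f v - f u| < e.
  rewrite !in_itv/= => /andP[ua ub] /andP[va vb] uv uvd.
  have := dP 1%N (fun=> u) (fun=> v); rewrite !big_ord_recl !big_ord0 !addr0; apply.
  - by move=> _; split.
  - by move=> i j _ _ _; rewrite (ord1 i) (ord1 j).
  - by rewrite -[ltLHS]ger0_norm ?subr_ge0// distrC.
have [yx|/ltW xy'] := leP y x; first by apply: key => //; rewrite distrC.
by rewrite distrC; apply: key.
Unshelve. all: by end_near. Qed.

Lemma itv_continuous_bounded a b f : {within `[a, b], continuous f} ->
  exists C, forall x, a <= x <= b -> `|f x| <= C.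
Proof.
move=> cf; have [ab|ba] := leP a b; last first.
  by exists 0 => x /andP[ax xb]; have := le_trans ax xb; rewrite leNgt ba.
have [x _ xM] := EVT_max ab cf; have [y _ yM] := EVT_min ab cf.
exists (Num.max (f x) (- f y)) => z zab.
by rewrite ler_norml le_max lerNl le_max lerN2 yM ?xM ?orbT.
Qed.

Lemma abs_contM a b f g :
  absolutely_continuous_on a b f -> absolutely_continuous_on a b g ->
  absolutely_continuous_on a b (fun x => f x * g x).
Proof.
move=> acf acg.
have [C fC] := itv_continuous_bounded a b f (abs_cont_within a b f acf).
have [D gD] := itv_continuous_bounded a b g (abs_cont_within a b g acg).
apply: (abs_cont_le a b f g D C acf acg) => s t sl le tr.
rewrite (_ : _ - _ = g t * (f t - f s) + f s * (g t - g s)); last by ring.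
rewrite (le_trans (ler_normD _ _))// !normrM lerD// ler_wpM2r//.
  by rewrite gD// tr (le_trans sl).
by rewrite fC// sl (le_trans le).
Qed.

(** The derivative is bounded on the compact interval, so the mean value theorem makes f
    Lipschitz. *)
Lemma derive_abs_cont a b f df : {within `[a, b], continuous f} ->
  {within `[a, b], continuous df} ->
  (forall x, x \in `]a, b[ -> is_derive x 1 f (df x)) ->
  absolutely_continuous_on a b f.
Proof.
move=> cf cdf dP; have [C CP] := itv_continuous_bounded a b df cdf.
apply: (lipschitz_abs_cont a b f C) => s t s0 st t1.
have sub : `[s, t]%classic `<=` `[a, b]%classic.
  move=> x /=; rewrite !in_itv/= => /andP[sx xt].
  by rewrite (le_trans s0)//=; exact: le_trans t1.
have dst x : x \in `]s, t[ -> is_derive x 1 f (df x).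
  rewrite in_itv/= => /andP[sx xt]; apply: dP.
  by rewrite in_itv/= (le_lt_trans s0)//=; exact: lt_le_trans t1.
have [c cst ->] := MVT_segment st dst (continuous_subspaceW sub cf).
rewrite normrM [`|t - s|]ger0_norm ?subr_ge0// ler_wpM2r ?subr_ge0// CP//.
by have := sub c cst; rewrite /= in_itv.
Qed.

(* A form of Cousin's lemma. *)
Lemma interval_induction (P : R -> Prop) a b : a <= b -> P a ->
  (forall c, a <= c <= b -> exists2 r, 0 < r & forall x y, a <= x <= c ->
    c <= y <= b -> c - r < x -> y < c + r -> P x -> P y) ->
  P b.
Proof.
move=> ab Pa step; pose S := [set x | a <= x <= b /\ P x].
have Sa : S a by split; rewrite ?lexx.
have hS : has_sup S.
  by split; [exists a|exists b => x -[/andP[]]].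
have c_b : sup S <= b by apply: ge_sup; [exists a|move=> x -[/andP[]]].
have a_c : a <= sup S by apply: ub_le_sup => //; case: hS.
have [|r r0 rP] := step (sup S); first by rewrite a_c.
have [x [/andP[ax xb] Px] xr] := sup_adherent r0 hS.
have xc : x <= sup S by apply: ub_le_sup; [case: hS|split; rewrite ?ax].
(* From x, close to the supremum on its left, P is carried across it: to b if b is within r / 2,
   otherwise to a point of S beyond sup S, which is absurd. *)
have [bc|cb] := leP b (sup S + r / 2).
  apply: (rP x b) => //; rewrite ?ax ?xc// ?c_b ?lexx//.
  by rewrite (le_lt_trans bc)// ltrD2l ltr_pdivrMr// mulr_natr mulr2n ltrDl.
have r2 : 0 < r / 2 by rewrite divr_gt0.
suff : sup S + r / 2 <= sup S by rewrite leNgt ltrDl r2.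
apply: ub_le_sup; first by case: hS.
have le1 : sup S <= sup S + r / 2 by rewrite lerDl ltW.
split; first by rewrite (le_trans a_c)//= ltW.
apply: (rP x) => //; rewrite ?ax ?xc// ?le1 ?(ltW cb)//.
by rewrite ltrD2l ltr_pdivrMr// mulr_natr mulr2n ltrDl.
Qed.

End AbsoluteContinuity.

(** * The fundamental theorem of calculus for absolutely continuous functions *)

Section FundamentalTheorem.
Context {R : realType}.
Implicit Types (f g H p : R -> R) (a b c d x l : R).

Local Notation mu := (@lebesgue_measure R).

Lemma ler_slope (u d l e : R) : d != 0 ->
  (`|u - l * d| <= e * `|d|) = (`|u / d - l| <= e).
Proof.
move=> d0; rewrite -ler_pdivrMr ?normr_gt0// -normfV -normrM.
by rewrite mulrBl mulfK.
Qed.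

(** A division-free form in which y = x is allowed. It has the same shape as [diff_quotient_near],
    so that ordinary derivatives and derivatives relative to [0, 1] can be exchanged. *)
Lemma is_derive_near f x l : is_derive x 1 f l <->
  forall e, 0 < e -> exists2 r, 0 < r & forall y, `|y - x| < r ->
    `|f y - f x - l * (y - x)| <= e * `|y - x|.
Proof.
split=> [[df <-] e e0|df].
  have : h^-1 *: ((f \o shift x) (h *: 1) - f x) @[h --> 0^'] --> 'D_1 f x.
    exact: df.
  move=> /cvgrPdist_le/(_ e e0)[r /= r0 rP]; exists r => // y yr.
  have [->|yx] := eqVneq y x; first by rewrite !subrr mulr0 subrr !normr0 mulr0.
  have yx0 : y - x != 0 by rewrite subr_eq0.
  have := rP (y - x); rewrite /ball_/= sub0r normrN => /(_ yr yx0).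
  by rewrite /= [_ *: 1]mulr1 subrK distrC ler_slope// mulrC.
have lim : h^-1 *: ((f \o shift x) (h *: 1) - f x) @[h --> 0^'] --> l.
  apply/cvgrPdist_le => e e0; have [r r0 rP] := df e e0.
  exists r => //= h; rewrite /ball_/= sub0r normrN => hr h0.
  have := rP (h + x); rewrite addrK => /(_ hr); rewrite [_ *: 1]mulr1.
  by rewrite ler_slope// distrC mulrC.
split; first by apply/cvg_ex; exists l.
exact: cvg_lim lim.
Qed.

Lemma measure_disjoint_itv n (s t : 'I_n -> R) : (forall i, s i <= t i) ->
  trivIset setT (fun i => `]s i, t i[%classic) ->
  mu (\big[setU/set0]_(i < n) `]s i, t i[%classic)
  = (\sum_(i < n) (t i - s i))%:E.
Proof.
move=> st tri; rewrite measure_semi_additive_ord//; last first.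
  by apply: bigsetU_measurable => i _.
rewrite -sumEFin; apply: eq_bigr => i _.
rewrite [LHS]lebesgue_measure_itv/= lte_fin; case: ifPn => // H0.
by rewrite (_ : t i = s i) ?subrr//; apply/eqP; rewrite eq_le st andbT leNgt.
Qed.

(** The union of the intervals has measure below d, so absolute continuity of the Lebesgue integral
    makes the integral of |p| over it small, and this integral dominates the sum of the
    increments. *)
Lemma primitive_abs_cont p a b : mu.-integrable setT (EFin \o p) ->
  absolutely_continuous_on a b (fun x => \int[mu]_(t in `]-oo, x]) p t).
Proof.
move=> ip e e0; have [d [d0 dP]] := integral_normr_continuous ip e0.
exists d => // n s t st tri ltd.
have le_st i : s i <= t i by have [_ []] := st i.
have ipS (A : set R) : measurable A -> mu.-integrable A (EFin \o p).
  by move=> mA; apply: integrableS ip.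
have iNp : mu.-integrable setT (EFin \o (fun x => `|p x|)).
  exact: integrable_norm.
have iNpS (A : set R) : measurable A ->
    mu.-integrable A (EFin \o (fun x => `|p x|)).
  by move=> mA; apply: integrableS iNp.
set U := \big[setU/set0]_(i < n) `]s i, t i[%classic.
have mU : measurable U by apply: bigsetU_measurable.
have UE : \int[mu]_(x in U) `|p x| = \sum_(i < n) \int[mu]_(x in `]s i, t i[) `|p x|.
  rewrite /Rintegral ge0_integral_bigsetU//=; last 3 first.
  - exact: index_enum_uniq.
  - by apply: sub_trivIset tri.
  - by have /integrableP[] := iNpS U mU.
  rewrite [LHS](_ : _ = fine (\sum_(i < n)
      (fine (\int[mu]_(x in `]s i, t i[) `|p x|%:E))%:E)%E); last first.
    congr fine; apply: eq_bigr => i _; rewrite fineK//.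
    by apply: integrable_fin_num => //; exact: iNpS.
  by rewrite sumEFin.
have muU : (mu U < d%:E)%E by rewrite /U measure_disjoint_itv.
apply: le_lt_trans (dP U mU muU).
rewrite UE ler_sum// => i _.
rewrite Rintegral_itvB ?bnd_simp ?ipS//.
rewrite (le_trans (le_normr_Rintegral _ _))// ?ipS//.
rewrite Rintegral_itv_bndo_bndc//.
exact: iNpS.
Qed.

(* Outside an open set U of small measure containing the exceptional null set,
   the increment of H over a short interval [x, y] around c is at most
   e (y - x); inside U the increments are small by absolute continuity. *)
Lemma abs_cont_derive0 H a b : a <= b -> absolutely_continuous_on a b H ->
  {ae mu, forall x, x \in `]a, b[ -> is_derive x 1 H 0} -> H b = H a.
Proof.
move=> ab acH [Z [mZ Z0 subZ]].
suff le e : 0 < e -> `|H b - H a| <= e * (b - a) + e.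
  apply/eqP; rewrite -subr_eq0 -normr_le0; apply/ler_addgt0Pr => e e0.
  rewrite add0r (le_trans (le (e / (b - a + 1)) _))//.
    by rewrite divr_gt0// ltr_wpDl// subr_ge0.
  rewrite -[X in _ + X]mulr1 -mulrDr mulfVK// gt_eqF//.
  by rewrite ltr_wpDl// subr_ge0.
move=> e0; have [d d0 dP] := acH e e0.
(* The hypothesis gives no derivative at a and b, so these two points join the exceptional set. *)
pose Z' : set R := Z `|` ([set a] `|` [set b]).
have Z'0 : mu Z' = 0.
  rewrite measureU0//; first exact: measurableU.
  by rewrite measureU0//; exact: lebesgue_measure_set1.
have mZ' : measurable Z' by do 2 apply: measurableU => //.
have Z'fin : (mu Z' < +oo)%E by rewrite Z'0.
have [U [oU subU ltU]] := lebesgue_regularity_outer mZ' Z'fin d0.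
have mU : measurable U by exact: open_measurable.
have {}ltU : (mu U < d%:E)%E.
  by rewrite -(setDKU subU) measureU0//; exact: measurableD.
(* The intervals are ordered, hence disjoint, and lie in U; the order makes it easy to append one
   more on the right. *)
pose fam x n (s t : nat -> R) := [/\
  (forall i, (i < n)%N -> [/\ a <= s i, s i <= t i & t i <= x]),
  (forall i j, (i < j < n)%N -> t i <= s j) &
  (forall i, (i < n)%N -> `]s i, t i[%classic `<=` U)].
(* This bound is propagated from a to b. At b the sum is below e, since the total length of the
   intervals is at most the measure of U. *)
pose P x := exists n s t, fam x n s t /\
  `|H x - H a| <= e * (x - a) + \sum_(i < n) `|H (t i) - H (s i)|.
suff [n [s [t [[st tri sU] le]]]] : P b.
  have st' (i : 'I_n) : a <= s i /\ s i <= t i /\ t i <= b.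
    by have [] := st i (ltn_ord i).
  have tri' : trivIset setT (fun i : 'I_n => `]s i, t i[%classic).
    apply/trivIsetP => i j _ _ ij; apply/seteqP; split => // x [/=].
    rewrite !in_itv/= => /andP[six xti] /andP[sjx xtj].
    have /orP[lij|lij] : (i < j)%N || (j < i)%N by rewrite -neq_ltn.
      have := tri i j; rewrite lij ltn_ord => /(_ isT).
      by rewrite leNgt (lt_trans sjx xti).
    have := tri j i; rewrite lij ltn_ord => /(_ isT).
    by rewrite leNgt (lt_trans six xtj).
  rewrite (le_trans le)// lerD2l ltW//.
  apply: (dP n (fun i => s i) (fun i => t i)) => //.
  rewrite -lte_fin -measure_disjoint_itv//; last by move=> i; case: (st' i) => _ [].
  apply: le_lt_trans ltU; apply: le_measure; rewrite ?inE//.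
    by apply: bigsetU_measurable.
  elim/big_ind : _ => [x []|A B AU BU x [/AU|/BU]|i _]//.
  exact: sU.
apply: (interval_induction P a b) => //.
  exists 0%N, (fun=> 0), (fun=> 0); split; first by split.
  by rewrite !subrr normr0 mulr0 big_ord0 addr0.
move=> c cab.
have [r r0 rP] : exists2 r, 0 < r & forall x y, x <= c -> c <= y ->
    c - r < x -> y < c + r ->
    `]x, y[%classic `<=` U \/ `|H y - H x| <= e * (y - x).
  have [Zc|Zc] := pselect (Z' c).
    have := open_nbhs_nbhs (conj oU (subU _ Zc)) => /nbhs_ballP[r /= r0 rU].
    exists r => // x y xc cy cx yc; left => z /=; rewrite in_itv/= => /andP[xz zy].
    apply: rU; rewrite /ball/= ltr_norml.
    by apply/andP; split; lra.
  have dc : is_derive c 1 H 0.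
    apply: contrapT => nd; apply: (Zc); left; apply: subZ => /= cP; apply/nd/cP.
    have /andP[ac cb] := cab; rewrite in_itv/= !lt_neqAle ac cb !andbT.
    apply/andP; split; apply/eqP => eqc; apply: (Zc); right.
      by left; rewrite -eqc.
    by right; rewrite eqc.
  have /is_derive_near/(_ e e0)[r r0 rP] := dc; exists r => // x y xc cy cx yc.
  right; have h1 : `|H y - H c| <= e * (y - c).
    by have := rP y; rewrite mul0r subr0 (ger0_norm (_ : 0 <= y - c)) ?subr_ge0//; apply; lra.
  have h2 : `|H c - H x| <= e * (c - x).
    have := rP x; rewrite mul0r subr0 (distrC x) (distrC (H x)).
    by rewrite (ger0_norm (_ : 0 <= c - x)) ?subr_ge0//; apply; lra.
  rewrite (_ : H y - H x = (H y - H c) + (H c - H x)); last by ring.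
  rewrite (le_trans (ler_normD _ _))// (le_trans (lerD h1 h2))//.
  by rewrite -mulrDr subrKA.
exists r => // x y /andP[ax xc] /andP[cy yb] cx yc [n [s [t [[st tri sU] le]]]].
have xy := le_trans xc cy.
have split_le : `|H y - H a| <= `|H y - H x| + `|H x - H a|.
  by rewrite (le_trans _ (ler_normD _ _))// subrKA.
have [xyU|Hxy] := rP x y xc cy cx yc; last first.
  exists n, s, t; split; first split => // i ni.
    by have [? ? tx] := st i ni; split => //; rewrite (le_trans tx).
  rewrite (le_trans split_le)// (le_trans (lerD Hxy le))//.
  by rewrite addrA -mulrDr subrKA.
(* The interval from x to y lies in U and to the right of all earlier ones, so its increment joins
   the sum. *)
exists n.+1, (fun i => if (i < n)%N then s i else x),
  (fun i => if (i < n)%N then t i else y); split; first split.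
- move=> i _; case: ifPn => [ni|_]; last by split.
  by have [? ? tx] := st i ni; split => //; rewrite (le_trans tx).
- move=> i j /andP[ij]; rewrite ltnS => jn.
  rewrite (leq_trans ij jn); case: ifPn => [jn'|_].
    by apply: tri; rewrite ij.
  by have [] := st i (leq_trans ij jn).
- by move=> i _; case: ifPn => [/sU|].
- rewrite big_ord_recr/= ltnn (eq_bigr (fun i : 'I_n => `|H (t i) - H (s i)|)).
    have exy : e * (x - a) <= e * (y - a).
      by rewrite ler_wpM2l ?(ltW e0)// lerD2r.
    by move: le split_le exy; set S := \sum_(i < n) _; lra.
  by move=> i _; rewrite ltn_ord.
Qed.

(** By Lebesgue differentiation the indefinite integral F of p has derivative p almost everywhere,
    so f - F is absolutely continuous with derivative 0 almost everywhere, hence takes equal values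
    at a and b. *)
Lemma abs_cont_FTC f p a b : a <= b -> absolutely_continuous_on a b f ->
  {ae mu, forall x, x \in `]a, b[ -> is_derive x 1 f (p x)} ->
  mu.-integrable `]a, b[ (EFin \o p) ->
  \int[mu]_(x in `]a, b[) p x = f b - f a.
Proof.
move=> ab acf fp ip; pose q := p \_ `]a, b[.
have iq : mu.-integrable setT (EFin \o q).
  by rewrite -restrict_EFin; apply/integrable_restrict => //=; rewrite setTI.
have iqS (A : set R) : measurable A -> mu.-integrable A (EFin \o q).
  by move=> mA; apply: integrableS iq.
pose F x := \int[mu]_(t in `]-oo, x]) q t.
have FE : F b - F a = \int[mu]_(x in `]a, b[) p x.
  rewrite /F Rintegral_itvB ?bnd_simp ?iqS//.
  rewrite -Rintegral_itv_bndo_bndc ?iqS//; apply: eq_Rintegral => x xab.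
  by rewrite /q patchE xab.
suff : f b - F b = f a - F a.
  by move=> e; rewrite -FE; move: e; lra.
apply: (abs_cont_derive0 (f - F) a b ab).
  apply: (abs_cont_le a b f F 1 1 acf (primitive_abs_cont q a b iq)) => s t _ _ _.
  rewrite !mul1r (_ : _ - _ = (f t - f s) - (F t - F s)) ?ler_normB//.
  by rewrite !fctE; ring.
have Fq := FTC1Ny (fun y => iqS _ (measurable_itv `]-oo, y]))
  (integrable_locally (measurable_itv _) ip).
apply: (@filterS2 _ _ (ae_filter_ringOfSetsType mu) _ _ _ _ fp Fq) => x {}fp [dF Fx] xab.
have {}fp := fp xab.
have {}dF : is_derive x 1 F (p x).
  have := derivableP dF; rewrite -derive1E Fx /q patchE ifT// inE.
  exact: xab.
by have := is_deriveB fp dF; rewrite subrr.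
Qed.

End FundamentalTheorem.

(** * The class W2 *)

Section W2.
Context {R : realType}.
Implicit Types (f g phi : R -> R) (x l : R) (A : set R).

Local Notation mu := (@lebesgue_measure R).

Lemma integrable_itv_bounded (a b : R) f C : measurable_fun `]a, b[ f ->
  (forall x, x \in `]a, b[ -> `|f x| <= C) ->
  mu.-integrable `]a, b[ (EFin \o f).
Proof.
move=> mf fC; have muab : (mu `]a, b[ < +oo)%E.
  by rewrite lebesgue_measure_itv/=; case: ifPn => // _; rewrite -EFinB ltry.
apply: measurable_bounded_integrable => //.
exists C; split; first exact: num_real.
by move=> M CM x /= xab; rewrite (le_trans (fC _ xab))// ltW.
Qed.

Lemma diff_quotient_near A f x l :
  (diff_quotient f x @ within A x^' --> l) <->
  forall e, 0 < e -> exists2 r, 0 < r & forall y, A y -> `|y - x| < r ->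
    `|f y - f x - l * (y - x)| <= e * `|y - x|.
Proof.
split=> [/cvgrPdist_le lim e e0|df].
  have [r /= r0 rP] := lim e e0; exists r => // y Ay yr.
  have [->|yx] := eqVneq y x; first by rewrite !subrr mulr0 subrr !normr0 mulr0.
  have yx0 : y - x != 0 by rewrite subr_eq0.
  have := rP y; rewrite /ball_/= distrC => /(_ yr yx Ay).
  by rewrite distrC ler_slope.
apply/cvgrPdist_le => e e0; have [r r0 rP] := df e e0.
exists r => //= y; rewrite /ball_/= => yr yx Ay.
rewrite distrC in yr; have := rP y Ay yr.
by rewrite ler_slope ?subr_eq0// distrC.
Qed.

Lemma derive_onP A f x : A x -> derivable_on A f ->
  diff_quotient f x @ within A x^' --> derive_on A f x.
Proof. by move=> Ax /(_ x Ax). Qed.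

(** Uniqueness of the limit needs a proper filter: every punctured neighbourhood of x must meet
    [0, 1]. The witness is taken towards the farther end point. *)
Lemma derive_on01 f x l : 0 <= x <= 1 ->
  diff_quotient f x @ within `[0, 1] x^' --> l -> derive_on `[0, 1] f x = l.
Proof.
move=> /andP[x0 x1] lim; apply: cvg_lim => //.
apply: Build_ProperFilter_ex => P [r /= r0 rP].
have [xh|hx] := leP x (1 / 2).
  pose m := Num.min r (1 / 2) / 2.
  have /andP[m0 mr] : 0 < m < r.
    rewrite /m; have : 0 < Num.min r (1/2) by rewrite lt_min r0 divr_gt0.
    have : Num.min r (1/2) <= r by rewrite ge_min lexx.
    by lra.
  have mh : m <= 1 / 2.
    have : Num.min r (1/2) <= 1/2 by rewrite ge_min lexx orbT.
    by rewrite /m; lra.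
  exists (x + m); apply: rP; rewrite /ball_/= ?in_itv/=.
  - by rewrite opprD addNKr normrN gtr0_norm.
  - by rewrite -subr_eq0 addrC addKr gt_eqF.
  - by lra.
pose m := Num.min r (1 / 2) / 2.
have /andP[m0 mr] : 0 < m < r.
  rewrite /m; have : 0 < Num.min r (1/2) by rewrite lt_min r0 divr_gt0.
  have : Num.min r (1/2) <= r by rewrite ge_min lexx.
  by lra.
have mh : m <= 1 / 2.
  have : Num.min r (1/2) <= 1/2 by rewrite ge_min lexx orbT.
  by rewrite /m; lra.
exists (x - m); apply: rP; rewrite /ball_/= ?in_itv/=.
- by rewrite opprB addrC subrK gtr0_norm.
- by rewrite -subr_eq0 addrC addKr oppr_eq0 gt_eqF.
- by lra.
Qed.

Section Phi.
Variables (phi : R -> R) (Wphi : W2_class phi).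

Lemma W2_diff_quotient x : 0 <= x <= 1 ->
  diff_quotient phi x @ within `[0, 1] x^' --> deriv01 phi x.
Proof. by move=> x01; apply: derive_onP; [rewrite /= in_itv|case: Wphi]. Qed.

Lemma W2_is_derive x : x \in `]0, 1[ -> is_derive x 1 phi (deriv01 phi x).
Proof.
rewrite in_itv/= => /andP[x0 x1]; apply/is_derive_near => e e0.
have /diff_quotient_near/(_ e e0)[r r0 rP] : diff_quotient phi x @ within `[0, 1] x^' --> deriv01 phi x.
  by apply: W2_diff_quotient; rewrite !ltW.
(* This radius keeps y inside [0, 1], where the relative estimate applies. *)
exists (Num.min r (Num.min x (1 - x))); first by rewrite !lt_min r0 x0 subr_gt0.
move=> y; rewrite !lt_min => /and3P[yr yx yx1]; apply: rP => //=.
move: yx yx1; rewrite !ltr_norml in_itv/= => /andP[? ?] /andP[? ?].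
by apply/andP; split; lra.
Qed.

Lemma W2_continuous : {within `[0, 1], continuous phi}.
Proof.
apply/subspace_continuousP => x; rewrite /= in_itv/= => x01.
apply/cvgrPdist_lt => e e0.
(* Tolerance 1 already bounds the increments from x by (1 + |phi'(x)|) |y - x|. *)
have /diff_quotient_near/(_ 1 ltr01)[r r0 rP] := W2_diff_quotient x x01.
pose C := 2 + `|deriv01 phi x|.
have C0 : 0 < C by rewrite ltr_wpDr.
rewrite near_withinE; near=> y => y01.
have yr : `|x - y| < r by near: y; exact: (@near_ball R R x r r0).
have ye : `|x - y| < e / C.
  by near: y; apply: (@near_ball R R x (e / C)); rewrite divr_gt0.
rewrite distrC in yr; rewrite distrC ltr_pdivlMr// in ye.
have := rP y y01 yr; rewrite [`|phi x - phi y|]distrC.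
have : `|phi y - phi x| <=
    `|phi y - phi x - deriv01 phi x * (y - x)| + `|deriv01 phi x| * `|y - x|.
  by rewrite -normrM (le_trans _ (ler_normD _ _))// subrK.
by have := normr_ge0 (y - x); move: ye; rewrite /C; lra.
Unshelve. all: by end_near. Qed.

Lemma W2_deriv_continuous : {within `[0, 1], continuous (deriv01 phi)}.
Proof. by apply: abs_cont_within; case: Wphi. Qed.

Lemma W2_abs_cont_fun : absolutely_continuous_on 0 1 phi.
Proof.
exact: derive_abs_cont W2_continuous W2_deriv_continuous W2_is_derive.
Qed.

Lemma W2_deriv2_integrable_sqr :
  mu.-integrable `]0, 1[ (EFin \o (fun x => deriv2 phi x ^+ 2)).
Proof.
have [_ _ _ /Lfun2_integrable_sqr i2] := Wphi.
have : mu.-integrable `]0, 1[ (EFin \o (fun x => ((deriv2 phi) \_ `]0, 1[) x ^+ 2)).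
  by apply: integrableS i2.
apply: eq_integrable => // x x01.
by rewrite /comp patchE x01.
Qed.

Lemma W2_deriv2_measurable : measurable_fun (`]0, 1[ : set R) (deriv2 phi).
Proof.
have [_ _ _] := Wphi; rewrite inE => /andP[]; rewrite inE/= => m _.
have m01 : measurable_fun (`]0, 1[ : set R) (deriv2 phi \_ `]0, 1[).
  by apply: measurable_funS m.
apply: eq_measurable_fun m01 => x x01.
by rewrite patchE x01.
Qed.

(** On a set of finite measure L2 is contained in L1, here through |v| <= 1 + v^2. *)
Lemma W2_deriv2_integrable : mu.-integrable `]0, 1[ (EFin \o deriv2 phi).
Proof.
have i1 : mu.-integrable `]0, 1[ (EFin \o (fun=> 1 : R)).
  apply: (integrable_itv_bounded _ _ _ 1) => // x _.
  by rewrite normr1.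
have := integrableD _ i1 W2_deriv2_integrable_sqr.
move=> /(_ (measurable_itv _)); apply: le_integrable => //.
  by apply/measurable_EFinP; exact: W2_deriv2_measurable.
move=> x _; rewrite /= lee_fin.
rewrite [leRHS]ger0_norm ?addr_ge0 ?sqr_ge0//.
by rewrite -real_normK ?num_real//; have := sqr_ge0 (`|deriv2 phi x| - 1); nra.
Qed.

End Phi.

End W2.

(** * The kernel of one cell *)

Section Cell.
Context {R : realType}.
Implicit Types (f g phi : R -> R) (a b c h s x : R).

Local Notation mu := (@lebesgue_measure R).

Lemma integrableM_bounded a b f g C :
  measurable_fun (`]a, b[ : set R) f ->
  (forall x, x \in `]a, b[ -> `|f x| <= C) ->
  mu.-integrable `]a, b[ (EFin \o g) ->
  mu.-integrable `]a, b[ (EFin \o (fun x => f x * g x)).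
Proof.
move=> mf fC ig.
have iC : mu.-integrable `]a, b[ (fun x => (C%:E * (g x)%:E)%E).
  exact: integrableZl.
apply: le_integrable iC => //.
  apply/measurable_EFinP; apply: measurable_funM => //.
  by have /integrableP[/measurable_EFinP] := ig.
move=> x xab; rewrite -EFinM !abse_EFin lee_fin !normrM ler_wpM2r//.
by rewrite (le_trans (fC x _))// ler_norm.
Qed.

Lemma integrable_sub_itv a b c d f : a <= c -> d <= b ->
  mu.-integrable `]a, b[ (EFin \o f) -> mu.-integrable `]c, d[ (EFin \o f).
Proof.
move=> ac db; apply: integrableS => //.
by apply: subset_itv; rewrite bnd_simp.
Qed.

Lemma continuous_integrable_itv a b f : {within `[a, b], continuous f} ->
  mu.-integrable `]a, b[ (EFin \o f).
Proof.
move=> cf; have : mu.-integrable `[a, b] (EFin \o f).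
  by apply: continuous_compact_integrable => //; exact: segment_compact.
by apply: integrableS => //; exact: subset_itvW.
Qed.

Lemma Rintegral_itv_split a b c f : a <= b -> b <= c ->
  mu.-integrable `]a, c[ (EFin \o f) ->
  \int[mu]_(x in `]a, c[) f x
  = \int[mu]_(x in `]a, b[) f x + \int[mu]_(x in `]b, c[) f x.
Proof.
move=> ab bc intf; have [->|cb] := eqVneq c b.
  by rewrite [X in _ + X](_ : _ = 0) ?addr0// set_itv_ge ?bnd_simp ?ltxx// Rintegral_set0.
have bc' : b < c by rewrite lt_neqAle eq_sym cb.
rewrite -(Rintegral_itvB intf (x := b)) ?bnd_simp//.
rewrite -Rintegral_itv_bndo_bndc; last exact: integrable_sub_itv intf.
by rewrite addrC subrK.
Qed.

Lemma smooth_FTC a b f df : a <= b -> (forall x, is_derive x 1 f (df x)) ->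
  continuous df -> \int[mu]_(x in `]a, b[) df x = f b - f a.
Proof.
move=> ab fdf cdf.
have cf : continuous f.
  by move=> x; apply/differentiable_continuous/derivable1_diffP; have [] := fdf x.
have cW g : continuous g -> {within `[a, b], continuous g}.
  by move=> cg; apply: continuous_subspaceT.
apply: abs_cont_FTC => //.
- by apply: derive_abs_cont (cW _ cf) (cW _ cdf) _ => x _; exact: fdf.
- by apply: aeW => x _; exact: fdf.
- exact: continuous_integrable_itv (cW _ cdf).
Qed.

Definition cell_kernel h s := h / 2 - 1 - s + h / (expR h - 1) * expR s.

Lemma is_derive_cell_kernel h a x :
  is_derive x 1 (fun x => cell_kernel h (x - a))
    (h / (expR h - 1) * expR (x - a) - 1).
Proof.
have de : is_derive x 1 (fun x => expR (x - a)) (expR (x - a)).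
  have := is_derive1_comp (f := expR) (g := fun x => x - a) (x := x)
    (a := expR (x - a)) (b := 1) _ _.
  rewrite mulr1; apply.
  by apply: is_derive_eq; rewrite subr0.
rewrite /cell_kernel; apply: is_derive_eq.
by rewrite !(scale0r, scaler0, subr0, addr0, add0r, sub0r) /GRing.scale/=; ring.
Qed.

Lemma continuous_cell_kernel h : continuous (cell_kernel h).
Proof.
move=> x; apply/differentiable_continuous/derivable1_diffP.
have [+ _] := is_derive_cell_kernel h 0 x.
by rewrite (_ : (fun x => _) = cell_kernel h)//; apply/funext => y; rewrite subr0.
Qed.

Lemma cell_kernel0 h : 0 < h ->
  cell_kernel h 0 = h * (expR h + 1) / (2 * (expR h - 1)) - 1.
Proof.
move=> h0; have : expR h - 1 != 0 by rewrite gt_eqF// subr_gt0 expR_gt1.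
by rewrite /cell_kernel expR0 => e0; field.
Qed.

Lemma cell_kernel_end h : 0 < h -> cell_kernel h h = cell_kernel h 0.
Proof.
move=> h0; have : expR h - 1 != 0 by rewrite gt_eqF// subr_gt0 expR_gt1.
by rewrite /cell_kernel expR0 => e0; field.
Qed.

Lemma cell_formula phi a h : W2_class phi -> 0 < h -> 0 <= a -> a + h <= 1 ->
  \int[mu]_(x in `]a, (a + h)[)
    (cell_kernel h (x - a) * (deriv2 phi x + deriv01 phi x))
  = \int[mu]_(x in `]a, (a + h)[) phi x
    - h / 2 * (phi a + phi (a + h))
    + cell_kernel h 0 * (deriv01 phi (a + h) - deriv01 phi a).
Proof.
move=> Wphi h0 a0 ah1; have ah : a <= a + h by rewrite lerDl ltW.
set b := a + h in ah1 ah *.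
set g := deriv01 phi; set K := fun x => cell_kernel h (x - a).
set u := fun x => deriv2 phi x + g x.
have dK : continuous (fun x => h / (expR h - 1) * expR (x - a) - 1).
  move=> x; apply: cvgB; last exact: cvg_cst.
  apply: cvgM; first exact: cvg_cst.
  apply: (@continuous_comp _ _ _ (fun x => x - a) expR); last exact: continuous_expR.
  by apply: cvgB; [exact: cvg_id|exact: cvg_cst].
have cK : continuous K.
  by move=> x; apply/differentiable_continuous/derivable1_diffP; have [] := is_derive_cell_kernel h a x.
have acK : absolutely_continuous_on a b K.
  apply: (derive_abs_cont a b K _ (continuous_subspaceT cK) (continuous_subspaceT dK)).
  by move=> x _; exact: is_derive_cell_kernel.
have acw : absolutely_continuous_on a b (fun x => h / 2 - (x - a)).
  apply: (lipschitz_abs_cont _ _ _ 1) => s t _ st _.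
  by rewrite mul1r distrC ger0_norm; lra.
have acg : absolutely_continuous_on a b g.
  by apply: abs_cont_sub (W2_abs_cont Wphi).
have acphi : absolutely_continuous_on a b phi.
  by apply: abs_cont_sub (W2_abs_cont_fun phi Wphi).
(* The weight h/2 - (x - a) is K - K', in which the exponentials cancel. *)
pose P x := K x * g x + (h / 2 - (x - a)) * phi x.
have acP : absolutely_continuous_on a b P.
  exact: abs_contD (abs_contM _ _ _ _ acK acg) (abs_contM _ _ _ _ acw acphi).
have dP : {ae mu, forall x, x \in `]a, b[ ->
    is_derive x 1 P (K x * u x - phi x)}.
  have := W2_derivable2 Wphi; apply: (@filterS _ _ (ae_filter_ringOfSetsType mu)) => x dg; rewrite in_itv/= => /andP[ax xb].
  have x01 : x \in `]0, 1[ by rewrite in_itv/= (le_lt_trans a0)// (lt_le_trans xb).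
  have /derivableP := dg x01; rewrite -derive1E => {}dg.
  have dphi := W2_is_derive phi Wphi x x01.
  have dw : is_derive x 1 (fun x => h / 2 - (x - a)) (- 1).
    by apply: is_derive_eq; ring.
  have := is_deriveD (is_deriveM (is_derive_cell_kernel h a x) dg) (is_deriveM dw dphi).
  move=> H; apply: (is_derive_eq H); rewrite /GRing.scale/= /u /K /cell_kernel -/g.
  by rewrite /deriv2 -/g; ring.
have iphi : mu.-integrable `]a, b[ (EFin \o phi).
  exact: continuous_integrable_itv (abs_cont_within _ _ _ acphi).
have iu : mu.-integrable `]a, b[ (EFin \o u).
  have i2 := integrable_sub_itv _ _ _ _ _ a0 ah1 (W2_deriv2_integrable phi Wphi).
  have ig := continuous_integrable_itv _ _ _ (abs_cont_within _ _ _ acg).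
  by have := integrableD _ i2 ig; apply; exact: measurable_itv.
have [C CP] := itv_continuous_bounded a b K (abs_cont_within _ _ _ acK).
have iKu : mu.-integrable `]a, b[ (EFin \o (fun x => K x * u x)).
  apply: (integrableM_bounded a b K u C) => //.
    apply: measurable_funTS; exact: continuous_measurable_fun.
  by move=> x; rewrite in_itv/= => /andP[ax xb]; rewrite CP// !ltW.
have : \int[mu]_(x in `]a, b[) (K x * u x - phi x) = P b - P a.
  apply: abs_cont_FTC => //.
  by have := integrableB _ iKu iphi; apply; exact: measurable_itv.
rewrite RintegralB// => /eqP; rewrite subr_eq => /eqP ->.
have bah : b - a = h by rewrite /b addrC addKr.
rewrite /P /K bah subrr cell_kernel_end// -/g.
by field.
Qed.

End Cell.

(** * The kernel of the error functional *)

Section Cells.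
Context {R : realType}.
Implicit Types (f g phi : R -> R) (a h x : R) (N n b : nat).

Local Notation mu := (@lebesgue_measure R).

(** The mean of the squared cell kernel, hence for h = 1/N the integral over [0, 1] of the squared
    periodic kernel. By [bernoulli_tail_cvg] it is also minus the Bernoulli series from n = 4 on. *)
Definition kernel_norm_sqr h := h ^+ 2 / 12 + 1 - h / 2 - h / (expR h - 1).

Lemma integral_cell_kernel_sqr a h : 0 < h ->
  \int[mu]_(x in `]a, (a + h)[) cell_kernel h (x - a) ^+ 2 = h * kernel_norm_sqr h.
Proof.
move=> h0; have e0 : expR h - 1 != 0 by rewrite gt_eqF// subr_gt0 expR_gt1.
pose D := h / (expR h - 1); pose p := h / 2 - 1.
(* With s = x - a the kernel is (p - s) + D e^s. The terms of Q are primitives of the three terms of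
   its square; for the cross term, e^s (p - s + 1) has derivative e^s (p - s). *)
pose Q x := - (p - (x - a)) ^+ 3 / 3 + 2 * D * (expR (x - a) * (p - (x - a) + 1))
  + D ^+ 2 / 2 * expR (x - a) ^+ 2.
transitivity (Q (a + h) - Q a); last first.
  by rewrite /Q [a + h]addrC addrK subrr expR0 /D /p /kernel_norm_sqr; field.
apply: smooth_FTC.
- by rewrite lerDl ltW.
- move=> x; have de : is_derive x 1 (fun x => expR (x - a)) (expR (x - a)).
    have := is_derive1_comp (f := expR) (g := fun x => x - a) (x := x)
      (a := expR (x - a)) (b := 1) _ _.
    rewrite mulr1; apply.
    by apply: is_derive_eq; rewrite subr0.
  have dp : is_derive x 1 (fun x => p - (x - a)) (- 1).
    by apply: is_derive_eq; ring.
  have dp1 : is_derive x 1 (fun x => p - (x - a) + 1) (- 1).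
    by apply: is_derive_eq; ring.
  rewrite /Q; apply: is_derive_eq.
  rewrite /GRing.scale/= /cell_kernel -/D -/p.
  by field.
- move=> x; apply: (@continuous_comp _ _ _ (fun x => cell_kernel h (x - a)) (fun y => y ^+ 2)).
    apply: (@continuous_comp _ _ _ (fun x => x - a) (cell_kernel h)).
      by apply: cvgB; [exact: cvg_id|exact: cvg_cst].
    exact: continuous_cell_kernel.
  exact: exprn_continuous.
Qed.

(* Clamping to [0, h] extends each cell kernel by its common end value, so
   that the sum is visibly continuous. *)
Definition periodic_kernel h N x := cell_kernel h 0 +
  \sum_(b < N) (cell_kernel h (Num.max 0 (Num.min (x - h * b%:R) h))
                - cell_kernel h 0).

(** Cells before n are clamped at h and cells after n at 0. At both ends the kernel equals the value
    being subtracted, so only the summand of cell n survives. *)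
Lemma periodic_kernelE h N x n : 0 < h -> (n < N)%N ->
  h * n%:R <= x <= h * n%:R + h ->
  periodic_kernel h N x = cell_kernel h (x - h * n%:R).
Proof.
move=> h0 nN /andP[nx xn]; rewrite /periodic_kernel (bigD1 (Ordinal nN))//=.
rewrite big1 => [|i /negP ni]; last first.
  have [lt|gt|e] := ltngtP i n.
  - have hi : h * i%:R + h <= h * n%:R.
      by rewrite -[X in _ + X]mulr1 -mulrDr ler_pM2l// natr1 ler_nat.
    rewrite min_r; last by lra.
    by rewrite max_r ?ltW// cell_kernel_end ?subrr.
  - have hi : h * n%:R + h <= h * i%:R.
      by rewrite -[X in _ + X]mulr1 -mulrDr ler_pM2l// natr1 ler_nat.
    rewrite max_l ?subrr// ge_min; apply/orP; left; lra.
  - by case: ni; apply/eqP/val_inj.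
rewrite addr0 addrC subrK min_l; last by lra.
by rewrite max_r//; lra.
Qed.

Lemma continuous_sum_ord n (F : nat -> R -> R) : (forall b, continuous (F b)) ->
  continuous (fun x => \sum_(b < n) F b x).
Proof.
move=> cF; elim: n => [|n IH] x.
  rewrite (_ : (fun _ => _) = cst 0); first exact: cst_continuous.
  by apply/funext => y; rewrite big_ord0.
rewrite (_ : (fun _ => _) = (fun y => \sum_(b < n) F b y + F n y)).
  by apply: cvgD; [exact: IH|exact: cF].
by apply/funext => y; rewrite big_ord_recr.
Qed.

Lemma continuous_periodic_kernel h N : continuous (periodic_kernel h N).
Proof.
move=> y; apply: cvgD; first exact: cvg_cst.
apply: (continuous_sum_ord N (fun b x =>
  cell_kernel h (Num.max 0 (Num.min (x - h * b%:R) h)) - cell_kernel h 0)).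
move=> b x; apply: cvgB; last exact: cvg_cst.
apply: (@continuous_comp _ _ _
  (fun x => Num.max 0 (Num.min (x - h * b%:R) h)) (cell_kernel h));
  last exact: continuous_cell_kernel.
apply: continuous_max; first exact: cst_continuous.
apply: continuous_min; last exact: cst_continuous.
by apply: cvgB; [exact: cvg_id|exact: cvg_cst].
Qed.

Lemma Rintegral_cells h n f : 0 <= h ->
  mu.-integrable `]0, (h * n%:R)[ (EFin \o f) ->
  \int[mu]_(x in `]0, (h * n%:R)[) f x
  = \sum_(b < n) \int[mu]_(x in `](h * b%:R), (h * b%:R + h)[) f x.
Proof.
move=> h0; elim: n => [_|n IH intf].
  by rewrite mulr0 set_itv_ge ?bnd_simp ?ltxx// Rintegral_set0 big_ord0.
have hn : h * n%:R + h = h * n.+1%:R by rewrite -natr1 mulrDr mulr1.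
rewrite (Rintegral_itv_split _ (h * n%:R))//; last 2 first.
- by rewrite mulr_ge0.
- by rewrite -hn lerDl.
rewrite big_ord_recr/= -IH ?hn//.
by apply: integrable_sub_itv intf => //; rewrite -hn lerDl.
Qed.

Lemma mesh_gt0 N : (0 < N)%N -> 0 < mesh N :> R.
Proof. by move=> N0; rewrite divr_gt0// ltr0n. Qed.

Lemma meshK N : (0 < N)%N -> mesh N * N%:R = 1 :> R.
Proof. by move=> N0; rewrite /mesh mul1r mulVf// pnatr_eq0 -lt0n. Qed.

(** Distributes the quadrature sum among the cells: an interior weight h is shared as h/2 by two
    neighbours, and the opposite end weights in [C1] are what a telescoping sum of differences
    leaves. *)
Lemma error_functional_nodes N (F G : nat -> R) : (0 < N)%N ->
  \sum_(0 <= b < N.+1) (C0 N b * F b + C1 N b * G b)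
  = \sum_(b < N) mesh N / 2 * (F b + F b.+1)
    - \sum_(b < N) cell_kernel (mesh N) 0 * (G b.+1 - G b).
Proof.
move=> N0; rewrite cell_kernel0 ?mesh_gt0// -!mulr_sumr.
rewrite -(big_mkord xpredT (fun b => G b.+1 - G b)) telescope_sumr//.
(* With N a successor the nodes 0 and N are distinct, so the tests in [C0] and [C1] do not
   overlap. *)
case: N N0 => // n _.
have -> : \sum_(b < n.+1) (F b + F b.+1)
    = F 0%N + \sum_(i < n) F i.+1 + (\sum_(i < n) F i.+1 + F n.+1).
  by rewrite big_split/= big_ord_recl [X in _ + X = _]big_ord_recr.
rewrite big_mkord big_ord_recl/= big_ord_recr/=.
rewrite (eq_bigr (fun i : 'I_n => mesh n.+1 * F i.+1)) => [|i _]; last first.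
  rewrite /bump/= add1n /C0 /C1/= eqSS (ltn_eqF (ltn_ord i)).
  by rewrite mul0r addr0.
rewrite -mulr_sumr /bump/= !add1n /C0 /C1/= eqxx/=.
by move: (_ / (2 * _)) => K; field.
Qed.

Lemma Rintegral_itv_cc_oo (a b : R) f : mu.-integrable `[a, b] (EFin \o f) ->
  \int[mu]_(x in `[a, b]) f x = \int[mu]_(x in `]a, b[) f x.
Proof.
move=> intf; rewrite -Rintegral_itv_obnd_cbnd; last first.
  by apply: integrableS intf => //; apply: subset_itv; rewrite bnd_simp.
rewrite -Rintegral_itv_bndo_bndc//.
by apply: integrableS intf => //; exact: subset_itvW.
Qed.

Lemma error_functional_cells N phi : (0 < N)%N -> W2_class phi ->
  error_functional N phi = \sum_(b < N)
    (\int[mu]_(x in `](mesh N * b%:R), (mesh N * b%:R + mesh N)[) phi x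
     - mesh N / 2 * (phi (mesh N * b%:R) + phi (mesh N * b%:R + mesh N))
     + cell_kernel (mesh N) 0 *
       (deriv01 phi (mesh N * b%:R + mesh N) - deriv01 phi (mesh N * b%:R))).
Proof.
move=> N0 Wphi; have h0 := mesh_gt0 N N0; have hN := meshK N N0.
have iphi : mu.-integrable `]0, 1[ (EFin \o phi).
  exact: continuous_integrable_itv (W2_continuous phi Wphi).
rewrite /error_functional error_functional_nodes//.
rewrite (Rintegral_itv_cc_oo 0 1 phi)//; last first.
  exact: continuous_compact_integrable (@segment_compact _ _ _) (W2_continuous phi Wphi).
rewrite -[X in `]0, X[]hN Rintegral_cells ?ltW ?hN//.
have step b : mesh N * b%:R + mesh N = mesh N * b.+1%:R :> R.
  by rewrite -natr1 mulrDr mulr1.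
under [RHS]eq_bigr do rewrite step.
under [in LHS]eq_bigr do rewrite step.
by rewrite !big_split/= !sumrN opprB; ring.
Qed.

Lemma periodic_kernel_bounded h N :
  exists C, forall x, x \in `]0, 1[ -> `|periodic_kernel h N x| <= C.
Proof.
have [C CP] := itv_continuous_bounded 0 1 (periodic_kernel h N)
  (continuous_subspaceT (continuous_periodic_kernel h N)).
exists C => x; rewrite in_itv/= => /andP[x0 x1].
by rewrite CP// !ltW.
Qed.

Lemma W2_operator_integrable phi : W2_class phi ->
  mu.-integrable `]0, 1[ (EFin \o (fun x => deriv2 phi x + deriv01 phi x)).
Proof.
move=> Wphi; have i2 := W2_deriv2_integrable phi Wphi.
have ig := continuous_integrable_itv _ _ _ (W2_deriv_continuous phi Wphi).
by have := integrableD _ i2 ig; apply; exact: measurable_itv.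
Qed.

Lemma kernel_operator_integrable h N phi : W2_class phi ->
  mu.-integrable `]0, 1[ (EFin \o (fun x =>
    periodic_kernel h N x * (deriv2 phi x + deriv01 phi x))).
Proof.
move=> Wphi; have [C CP] := periodic_kernel_bounded h N.
apply: (integrableM_bounded _ _ _ _ C) => //; last exact: W2_operator_integrable.
by apply: measurable_funTS; apply: continuous_measurable_fun; exact: continuous_periodic_kernel.
Qed.

Lemma cell_le1 N n : (n < N)%N -> mesh N * n%:R + mesh N <= 1 :> R.
Proof.
move=> nN; have N0 : (0 < N)%N := leq_ltn_trans (leq0n n) nN.
rewrite (_ : _ + _ = mesh N * n.+1%:R); last by rewrite -natr1 mulrDr mulr1.
by rewrite -[leRHS](meshK N N0) ler_pM2l ?mesh_gt0// ler_nat.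
Qed.

Lemma error_functionalE N phi : (0 < N)%N -> W2_class phi ->
  error_functional N phi = \int[mu]_(x in `]0, 1[)
    (periodic_kernel (mesh N) N x * (deriv2 phi x + deriv01 phi x)).
Proof.
move=> N0 Wphi; have h0 := mesh_gt0 N N0; have hN := meshK N N0.
rewrite error_functional_cells// -[X in `]0, X[]hN Rintegral_cells ?ltW ?hN//; last first.
  exact: kernel_operator_integrable.
apply: eq_bigr => b _; rewrite -cell_formula ?cell_le1 ?mulr_ge0 ?(ltW h0)//.
apply: eq_Rintegral => x; rewrite inE/= in_itv/= => /andP[bx xb].
by rewrite (periodic_kernelE _ _ _ b)// !ltW.
Qed.

Lemma integral_periodic_kernel_sqr N : (0 < N)%N ->
  \int[mu]_(x in `]0, 1[) periodic_kernel (mesh N) N x ^+ 2 = kernel_norm_sqr (mesh N).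
Proof.
move=> N0; have h0 := mesh_gt0 N N0; have hN := meshK N N0.
rewrite -[X in `]0, X[]hN Rintegral_cells ?ltW ?hN//; last first.
  apply: continuous_integrable_itv; apply: continuous_subspaceT => x.
  apply: (@continuous_comp _ _ _ (periodic_kernel (mesh N) N) (fun y => y ^+ 2)); last exact: exprn_continuous.
  exact: continuous_periodic_kernel.
rewrite (eq_bigr (fun=> mesh N * kernel_norm_sqr (mesh N))) => [|b _].
  by rewrite sumr_const card_ord -mulr_natr mulrAC hN mul1r.
rewrite -(integral_cell_kernel_sqr (mesh N * b%:R))//.
apply: eq_Rintegral => x; rewrite inE/= in_itv/= => /andP[bx xb].
by rewrite (periodic_kernelE _ _ _ b)// !ltW.
Qed.

End Cells.

(** * The dual norm *)

Section DualNorm.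
Context {R : realType}.
Implicit Types (f g phi : R -> R) (a x : R) (N : nat).

Local Notation mu := (@lebesgue_measure R).

Lemma is_derive_continuous f x (l : R) : is_derive x 1 f l ->
  {for x, continuous f}.
Proof. by move=> [df _]; apply/differentiable_continuous/derivable1_diffP. Qed.

(** The integral from b has a two-sided derivative only to the right of b; continuity from a < b on
    covers the base point. *)
Lemma primitive_right f a b : a < b -> (forall x, a < x -> {for x, continuous f}) ->
  exists F, forall x, b < x -> is_derive x 1 F (f x).
Proof.
move=> ab cf; exists (fun x => \int[mu]_(t in `[b, x]) f t) => x bx.
have intf : mu.-integrable `[b, (x + 1)] (EFin \o f).
  apply: continuous_compact_integrable; first exact: segment_compact.
  apply: continuous_in_subspaceT => y; rewrite inE/= in_itv/= => /andP[byy _].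
  by apply: cf; exact: lt_le_trans byy.
have xx1 : x < x + 1 by rewrite ltrDl.
have [dF Fx] := continuous_FTC1_closed xx1 intf bx (cf x (lt_trans ab bx)).
by have := derivableP dF; rewrite -derive1E Fx.
Qed.

Lemma Lfun2_bounded_itv f (C : R) :
  measurable_fun (`]0, 1[ : set R) f -> (forall x, x \in `]0, 1[ -> `|f x| <= C) ->
  f \_ `]0, 1[ \in Lfun mu 2%:E.
Proof.
move=> mf fC; rewrite inE; apply/andP; split; rewrite inE/=.
  by apply/(measurable_restrictT _ _).1.
rewrite /finite_norm unlock poweR_lty//.
have i2 : mu.-integrable `]0, 1[ (EFin \o (fun x => f x ^+ 2)).
  apply: (integrable_itv_bounded _ _ _ (C ^+ 2)).
    exact: measurable_funX.
  by move=> x x01; rewrite normrX lerXn2r ?nnegrE ?fC// (le_trans _ (fC x x01)).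
have := integrable_lty _ i2; move=> /(_ (measurable_itv _)); apply: le_lt_trans.
rewrite [leRHS]integral_mkcond le_eqVlt; apply/orP; left; apply/eqP.
apply: eq_integral => x _; rewrite /= !patchE; case: ifPn => _.
  by rewrite /= powR_mulrn// real_normK ?num_real.
(* Off the interval the restriction takes the default [point] of R, which is 0. *)
by rewrite (_ : point = 0 :> R)// normr0 powR0.
Qed.

Section Extremal.
Variables (f : R -> R) (cf : continuous f).

(** Integrating factor: if G' = e^x f, then g = e^(-x) G satisfies g' + g = f, and phi is a
    primitive of g. The thresholds -3, -2, -1 leave room for two integrations to the left of 0, so
    that g and phi have two-sided derivatives on all of [0, 1]. *)
Lemma exists_W2_operator : exists2 phi, W2_class phi &
  forall x, x \in `]0, 1[ -> deriv2 phi x + deriv01 phi x = f x.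
Proof.
have cef x : -3 < x -> {for x, continuous (fun t => expR t * f t)}.
  by move=> _; apply: cvgM; [exact: continuous_expR|exact: cf].
have [G GP] := primitive_right _ (-3) (-2) ltac:(lra) cef.
pose g x := expR (- x) * G x.
have gP x : -2 < x -> is_derive x 1 g (f x - g x).
  move=> x2; have dG := GP x x2.
  have de : is_derive x 1 (fun x => expR (- x)) (- expR (- x)).
    have := is_derive1_comp (f := expR) (g := -%R) (x := x)
      (a := expR (- x)) (b := - 1) _ _.
    by rewrite mulrN1; apply; apply: is_derive_eq.
  apply: (is_derive_eq (is_deriveM de dG)).
  by rewrite /GRing.scale/= mulrA [_ * expR x]mulrC expRxMexpNx_1 /g; ring.
have cg x : -2 < x -> {for x, continuous g}.
  by move=> /gP; exact: is_derive_continuous.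
have [phi phiP] := primitive_right _ (-2) (-1) ltac:(lra) cg.
have dphi01 x : 0 <= x <= 1 ->
    diff_quotient phi x @ within `[0, 1] x^' --> g x.
  move=> /andP[x0 x1]; apply/diff_quotient_near => e e0.
  have /is_derive_near/(_ e e0)[r r0 rP] : is_derive x 1 phi (g x) by apply: phiP; lra.
  by exists r => // y _; exact: rP.
have d1E x : 0 <= x <= 1 -> deriv01 phi x = g x.
  by move=> x01; apply: derive_on01 => //; exact: dphi01.
(* [deriv01 phi] is known to equal g on [0, 1] only, so the radius is cut down to stay inside. *)
have d2P x : x \in `]0, 1[ -> is_derive x 1 (deriv01 phi) (f x - g x).
  rewrite in_itv/= => /andP[x0 x1]; apply/is_derive_near => e e0.
  have /is_derive_near/(_ e e0)[r r0 rP] : is_derive x 1 g (f x - g x) by apply: gP; lra.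
  exists (Num.min r (Num.min x (1 - x))); first by rewrite !lt_min r0 x0 subr_gt0.
  move=> y; rewrite !lt_min => /and3P[yr yx yx1].
  rewrite !d1E; [exact: rP|by rewrite !ltW|].
  move: yx yx1; rewrite !ltr_norml => /andP[? ?] /andP[? ?].
  by apply/andP; split; lra.
have d2E x : x \in `]0, 1[ -> deriv2 phi x = f x - g x.
  by move=> x01; have [_ <-] := d2P x x01; rewrite /deriv2 derive1E.
have cgW : {within `[0, 1], continuous g}.
  apply: continuous_in_subspaceT => x; rewrite inE/= in_itv/= => /andP[x0 _].
  by apply: cg; lra.
have cfgW : {within `[0, 1], continuous (fun x => f x - g x)}.
  apply: continuous_in_subspaceT => x; rewrite inE/= in_itv/= => /andP[x0 _].
  by apply: cvgB; [exact: cf|apply: cg; lra].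
exists phi; last first.
  move=> x x01; rewrite d2E// d1E ?subrK//.
  by move: x01; rewrite in_itv/= => /andP[x0 x1]; rewrite !ltW.
split.
- move=> x; rewrite /= in_itv/= => x01; apply/cvg_ex; exists (g x).
  exact: dphi01.
- have acg : absolutely_continuous_on 0 1 g.
    apply: (derive_abs_cont 0 1 g _ cgW cfgW) => x.
    by rewrite in_itv/= => /andP[x0 _]; apply: gP; lra.
  (* Absolute continuity on [0, 1] sees only the values there, where [deriv01 phi] and g agree. *)
  apply: (abs_cont_le 0 1 g g 1 0 acg acg) => s t s0 st t1.
  rewrite mul1r mul0r addr0 !d1E//.
    by rewrite s0 (le_trans st).
  by rewrite t1 (le_trans s0).
- by apply: aeW => x /d2P[].
- have [C CP] := itv_continuous_bounded 0 1 _ cfgW.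
  rewrite (_ : _ \_ _ = (fun x => f x - g x) \_ `]0, 1[); last first.
    apply/funext => x; rewrite !patchE; case: ifPn => //; rewrite inE/= => x01.
    exact: d2E.
  apply: (Lfun2_bounded_itv _ C).
    apply: (measurable_funS (E := `[0, 1]%classic : set R)) => //.
      exact: subset_itvW.
    apply: subspace_continuous_measurable_fun => //.
  move=> x; rewrite in_itv/= => /andP[x0 x1]; apply: CP.
  by rewrite !ltW.
Qed.

End Extremal.

Lemma W2_seminormE phi : W2_seminorm phi = 1 ->
  \int[mu]_(x in `]0, 1[) (deriv2 phi x + deriv01 phi x) ^+ 2 = 1.
Proof.
rewrite /W2_seminorm => s1; rewrite -[LHS]sqr_sqrtr ?s1 ?expr1n//.
by apply: Rintegral_ge0 => x _; exact: sqr_ge0.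
Qed.

Lemma W2_operator_integrable_sqr phi : W2_class phi -> mu.-integrable `]0, 1[
  (EFin \o (fun x => (deriv2 phi x + deriv01 phi x) ^+ 2)).
Proof.
move=> Wphi.
have [C CP] := itv_continuous_bounded 0 1 _ (W2_deriv_continuous phi Wphi).
have mg : measurable_fun (`]0, 1[ : set R) (deriv01 phi).
  apply: (measurable_funS (E := `[0, 1]%classic : set R)) => //.
    exact: subset_itvW.
  by apply: subspace_continuous_measurable_fun => //; exact: W2_deriv_continuous.
have CP' x : x \in `]0, 1[ -> `|deriv01 phi x| <= C.
  by rewrite in_itv/= => /andP[x0 x1]; apply: CP; rewrite !ltW.
have mv := W2_deriv2_measurable phi Wphi.
have i2 := W2_deriv2_integrable_sqr phi Wphi.
have ig2 : mu.-integrable `]0, 1[ (EFin \o (fun x => deriv01 phi x ^+ 2)).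
  apply: (integrable_itv_bounded _ _ _ (C ^+ 2)); first exact: measurable_funX.
  move=> x x01; rewrite normrX lerXn2r ?nnegrE ?CP'//.
  by rewrite (le_trans _ (CP' x x01)).
have ivg : mu.-integrable `]0, 1[ (EFin \o (fun x => deriv01 phi x * deriv2 phi x)).
  by apply: (integrableM_bounded _ _ _ _ C) => //; exact: W2_deriv2_integrable.
have isum : mu.-integrable `]0, 1[ (EFin \o (fun x => deriv2 phi x ^+ 2 +
    (deriv01 phi x ^+ 2 + 2 * (deriv01 phi x * deriv2 phi x)))).
  have i3 : mu.-integrable `]0, 1[ (EFin \o (fun x => 2 * (deriv01 phi x * deriv2 phi x))).
    by have := integrableZl _ 2 ivg; apply; exact: measurable_itv.
  have i4 : mu.-integrable `]0, 1[ (EFin \o (fun x => deriv01 phi x ^+ 2 + 2 * (deriv01 phi x * deriv2 phi x))).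
    by have := integrableD _ ig2 i3; apply; exact: measurable_itv.
  by have := integrableD _ i2 i4; apply; exact: measurable_itv.
apply: eq_integrable isum => //= x _; congr EFin; ring.
Qed.

(** Cauchy-Schwarz for u of norm 1: with L the integral of k u, expanding 0 <= int (k - L u)^2 gives
    0 <= |k|^2 - L^2. *)
Lemma error_functional_le N phi : (0 < N)%N -> W2_class phi ->
  W2_seminorm phi = 1 -> error_functional N phi ^+ 2 <= kernel_norm_sqr (mesh N).
Proof.
move=> N0 Wphi /W2_seminormE; set u := fun x => deriv2 phi x + deriv01 phi x.
rewrite error_functionalE//; set k := periodic_kernel (mesh N) N => u1.
set L := \int[mu]_(x in `]0, 1[) (k x * u x).
have ik : mu.-integrable `]0, 1[ (EFin \o (fun x => k x ^+ 2)).
  apply: continuous_integrable_itv; apply: continuous_subspaceT => x.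
  apply: (@continuous_comp _ _ _ k (fun y => y ^+ 2)); last exact: exprn_continuous.
  exact: continuous_periodic_kernel.
have iu := W2_operator_integrable_sqr phi Wphi; rewrite -/u in iu.
have iku := kernel_operator_integrable (mesh N) N phi Wphi; rewrite -/u -/k in iku.
have ikuL : mu.-integrable `]0, 1[ (EFin \o (fun x => (2 * L) * (k x * u x))).
  by have := integrableZl _ (2 * L) iku; apply; exact: measurable_itv.
have iuL : mu.-integrable `]0, 1[ (EFin \o (fun x => L ^+ 2 * u x ^+ 2)).
  by have := integrableZl _ (L ^+ 2) iu; apply; exact: measurable_itv.
have ikk : mu.-integrable `]0, 1[ (EFin \o (fun x => k x ^+ 2 - 2 * L * (k x * u x))).
  by have := integrableB _ ik ikuL; apply; exact: measurable_itv.
have : 0 <= \int[mu]_(x in `]0, 1[) (k x ^+ 2 - 2 * L * (k x * u x) + L ^+ 2 * u x ^+ 2).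
  apply: Rintegral_ge0 => x _.
  by rewrite (_ : _ + _ = (k x - L * u x) ^+ 2) ?sqr_ge0//; ring.
rewrite RintegralD// RintegralB// !RintegralZl// integral_periodic_kernel_sqr//.
rewrite -/L u1; lra.
Qed.

Lemma kernel_norm_sqr_ge0 N : (0 < N)%N -> 0 <= kernel_norm_sqr (mesh N) :> R.
Proof.
move=> N0; rewrite -integral_periodic_kernel_sqr//.
by apply: Rintegral_ge0 => x _; exact: sqr_ge0.
Qed.

Lemma W2_dual_norm_error N : (0 < N)%N ->
  W2_dual_norm (error_functional N) = (Num.sqrt (kernel_norm_sqr (mesh N)) : R)%:E.
Proof.
move=> N0; set M := Num.sqrt _.
have M2 : M ^+ 2 = kernel_norm_sqr (mesh N) by rewrite sqr_sqrtr// kernel_norm_sqr_ge0.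
apply/eqP; rewrite eq_le; apply/andP; split.
  apply: ge_ereal_sup => _ [phi [Wphi s1] <-]; rewrite lee_fin.
  by rewrite -sqrtr_sqr ler_wsqrtr// error_functional_le.
pose k : R -> R := periodic_kernel (mesh N) N.
have ck : continuous k := continuous_periodic_kernel (mesh N) N.
suff [phi [Wphi s1 lM]] : exists phi, [/\ W2_class phi, W2_seminorm phi = 1 &
    M <= `|error_functional N phi| ].
  by apply: le_ereal_sup_tmp; exists `|error_functional N phi|%:E;
    [exists phi|rewrite lee_fin].
have seminormE phi f : (forall x, x \in `]0, 1[ -> deriv2 phi x + deriv01 phi x = f x) ->
    W2_seminorm phi = Num.sqrt (\int[mu]_(x in `]0, 1[) f x ^+ 2).
  by move=> phif; congr Num.sqrt; apply: eq_Rintegral => x; rewrite inE => x01; rewrite phif.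
(* If M = 0 one cannot normalise k by 1 / M, but any function of semi-norm 1 will do; a solution of
   phi'' + phi' = 1 is one. *)
have [M0|M0] := eqVneq M 0.
  have [phi Wphi phi1] := exists_W2_operator (fun=> 1) (fun x => cvg_cst _).
  exists phi; split; [by []| |by rewrite M0].
  rewrite (seminormE _ _ phi1) (@eq_Rintegral _ _ _ mu _ (fun=> 1)) => [|x _]; last by rewrite expr1n.
  by rewrite Rintegral_cst//= mul1r lebesgue_measure_itv/= lte_fin ltr01 oppr0 adde0 sqrtr1.
have [phi Wphi phik] := exists_W2_operator (fun x => k x / M)
  (fun x => cvgM (ck x) (cvg_cst _)).
have ikk : mu.-integrable `]0, 1[ (EFin \o (fun x => k x ^+ 2)).
  apply: continuous_integrable_itv; apply: continuous_subspaceT => x.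
  apply: (@continuous_comp _ _ _ k (fun y => y ^+ 2)); last exact: exprn_continuous.
  exact: ck.
exists phi; split => //.
  rewrite (seminormE _ _ phik).
  under eq_Rintegral do rewrite expr_div_n.
  by rewrite RintegralZr// integral_periodic_kernel_sqr// M2 divff ?sqrtr1// -M2 expf_neq0.
rewrite error_functionalE// (@eq_Rintegral _ _ _ mu _ (fun x => k x ^+ 2 / M)); last first.
  by move=> x; rewrite inE => x01; rewrite phik// mulrA expr2.
rewrite RintegralZr// integral_periodic_kernel_sqr// -M2 expr2 mulfK//.
exact: ler_norm.
Qed.

End DualNorm.

(** * Power series *)

Section PowerSeries.
Context {R : realType}.
Implicit Types (a c : nat -> R) (m n : nat) (x : R).

(** Convergence at 2 bounds the terms a_n 2^n, so for x in [0, 1] the tail from m on is dominated by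
    a constant times x^m times a geometric series of ratio 1/2. *)
Lemma power_series_remainder a m : cvgn (series (fun n => a n * 2 ^+ n)) ->
  exists C, forall x l, 0 <= x <= 1 ->
    series (fun n => a n * x ^+ n) @ \oo --> l ->
    `|l - \sum_(0 <= i < m) a i * x ^+ i| <= C * x ^+ m.
Proof.
move=> cv; have cv0 : cvgn (fun n => a n * 2 ^+ n).
  by apply/cvg_ex; exists 0; exact: cvg_series_cvg_0.
have [K [Kr KP]] := cvg_seq_bounded cv0.
pose C := `|K| + 1.
have CP n : `|a n * 2 ^+ n| <= C.
  by apply: KP => //; rewrite /C (le_lt_trans (ler_norm K))// ltrDl.
have C0 : 0 <= C by rewrite addr_ge0.
exists (C * 2) => x l /andP[x0 x1] sl.
have termP n : (m <= n)%N -> `|a n * x ^+ n| <= C * x ^+ m * (1 / 2) ^+ n.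
  move=> mn; rewrite normrM [`|x ^+ n|]ger0_norm ?exprn_ge0//.
  have -> : `|a n| = `|a n * 2 ^+ n| * (1 / 2) ^+ n.
    rewrite normrM [`|2 ^+ n|]ger0_norm ?exprn_ge0// -mulrA -exprMn.
    by rewrite (_ : 2 * (1 / 2) = 1 :> R) ?expr1n ?mulr1//; field.
  rewrite mulrAC ler_wpM2r ?exprn_ge0// ler_pM ?exprn_ge0//.
  by rewrite -(subnKC mn) exprD ler_piMr ?exprn_ge0// exprn_ile1.
have geo n : \sum_(m <= i < n) (1 / 2 : R) ^+ i <= 2.
  have [nm|mn] := leqP n m; first by rewrite big_geq.
  have : \sum_(0 <= i < n) (1 / 2 : R) ^+ i = 2 - 2 * (1 / 2) ^+ n.
    elim: n {mn} => [|n IH]; first by rewrite big_nil expr0; ring.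
    by rewrite big_nat_recr//= IH exprS; field.
  rewrite (big_cat_nat (leq0n m) (ltnW mn))/= => e.
  have s0 : 0 <= \sum_(0 <= i < m) (1 / 2 : R) ^+ i.
    by apply: sumr_ge0 => i _; rewrite exprn_ge0.
  have p0 : 0 <= (1 / 2 : R) ^+ n by rewrite exprn_ge0.
  by move: e s0 p0; lra.
have tail n : (m <= n)%N ->
    `|series (fun n => a n * x ^+ n) n - \sum_(0 <= i < m) a i * x ^+ i|
    <= C * 2 * x ^+ m.
  move=> mn; rewrite /series/= (big_cat_nat (leq0n m) mn)/= [X in `|X|]addrC addKr.
  rewrite (le_trans (ler_norm_sum _ _ _))//.
  rewrite (@le_trans _ _ (\sum_(m <= i < n) C * x ^+ m * (1 / 2) ^+ i))//.
    by rewrite !big_nat; apply: ler_sum => i /andP[mi _]; exact: termP.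
  by rewrite -mulr_sumr [leRHS]mulrAC ler_wpM2l// mulr_ge0 ?exprn_ge0.
have cvS : `|series (fun n => a n * x ^+ n) n - \sum_(0 <= i < m) a i * x ^+ i|
    @[n --> \oo] --> `|l - \sum_(0 <= i < m) a i * x ^+ i|.
  by apply: cvg_norm; apply: cvgB => //; exact: cvg_cst.
rewrite -(cvg_lim _ cvS)//; apply: limr_le; first by apply/cvg_ex; eexists; exact: cvS.
by exists m => // n /= mn; exact: tail.
Qed.

(** Small values of x force the constant coefficient to vanish; the rest is divisible by x, and
    induction applies to the quotient. *)
Lemma polynomial_small_eq0 m c (C : R) :
  (forall x, 0 < x -> x <= 1 -> `|\sum_(0 <= i < m) c i * x ^+ i| <= C * x ^+ m) ->
  forall i, (i < m)%N -> c i = 0.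
Proof.
elim: m c => [|m IH] c cP; first by [].
have splitE x : \sum_(0 <= i < m.+1) c i * x ^+ i
    = c 0%N + x * \sum_(0 <= i < m) c i.+1 * x ^+ i.
  rewrite big_nat_recl// expr0 mulr1 mulr_sumr; congr (_ + _).
  by apply: eq_bigr => i _; rewrite exprS mulrCA.
have c0 : c 0%N = 0.
  apply/eqP/negPn/negP => c00; pose t := `|c 0%N|.
  have t0 : 0 < t by rewrite normr_gt0.
  pose K := \sum_(0 <= i < m) `|c i.+1| + `|C|.
  have K0 : 0 <= K by rewrite addr_ge0// sumr_ge0.
  have bound x : 0 < x -> x <= 1 -> t <= K * x.
    move=> x0 x1; have x0' := ltW x0.
    have xi i : x ^+ i <= 1 by rewrite exprn_ile1.
    have := cP x x0 x1; rewrite splitE.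
    set S := \sum_(0 <= i < m) c i.+1 * x ^+ i => le.
    have S_le : `|S| <= \sum_(0 <= i < m) `|c i.+1|.
      rewrite (le_trans (ler_norm_sum _ _ _))// ler_sum// => i _.
      by rewrite normrM [`|x ^+ i|]ger0_norm ?exprn_ge0// ler_piMr.
    have tle : t <= `|c 0%N + x * S| + x * `|S|.
      rewrite /t -[x in x * `|S|]gtr0_norm// -normrM.
      by rewrite (le_trans _ (ler_normB _ _))// addrK.
    have Cx : C * x ^+ m.+1 <= `|C| * x.
      rewrite exprS mulrCA mulrC ler_wpM2r//.
      rewrite (le_trans (ler_norm _))// normrM [`|x ^+ m|]ger0_norm ?exprn_ge0//.
      by rewrite ler_piMr.
    have xS : x * `|S| <= x * \sum_(0 <= i < m) `|c i.+1| by rewrite ler_wpM2l// ltW.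
    by rewrite /K mulrDl [_ * x]mulrC; move: tle le Cx xS; lra.
  (* At x = t / (K + 1 + t), which is at most 1, the bound t <= K x would give t + t^2 <= 0. *)
  have d0 : 0 < K + 1 + t by lra.
  have := bound (t / (K + 1 + t)); rewrite divr_gt0// => /(_ isT).
  rewrite ler_pdivrMr// mul1r mulrA ler_pdivlMr//.
  have tt : 0 < t * t by rewrite mulr_gt0.
  have td : t <= K + 1 + t by lra.
  by move=> /(_ td); lra.
case=> [_|i]; first exact: c0.
rewrite ltnS; apply: (IH (fun i => c i.+1)) => x x0 x1.
have := cP x x0 x1; rewrite splitE c0 add0r exprS normrM gtr0_norm//.
by rewrite mulrCA ler_pM2l.
Qed.

(* Here and below 30240 = 720 * 42 stays a product: literals denote unary
   naturals, which overflow the stack when they are large. *)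
Definition bernoulli_poly (x : R) :=
  1 - x / 2 + x ^+ 2 / 12 - x ^+ 4 / 720 + x ^+ 6 / (720 * 42).

(** [bernoulli_poly] times the Taylor polynomial of e^x - 1 of degree 8 agrees with x through degree
    8. Dividing the O(x^9) error by e^x - 1 >= x costs one power. *)
Lemma bernoulli_poly_approx : exists C, forall x, 0 < x -> x <= 1 ->
  `|x / (expR x - 1) - bernoulli_poly x| <= C * x ^+ 8.
Proof.
have cv2 : cvgn (series (fun n => n`!%:R^-1 * (2 : R) ^+ n)).
  by have := is_cvg_series_exp_coeff (2 : R); rewrite exp_coeffE.
have [D DP] := power_series_remainder _ 9 cv2.
(* The 1 is for the polynomial defect [q_le]; 3 bounds [bernoulli_poly] on [0, 1] and multiplies the
   exponential remainder D x^9. *)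
exists (1 + 3 * D) => x x0 x1; have x0' := ltW x0.
have x01 : 0 <= x <= 1 by rewrite ltW.
have cx : series (fun n => n`!%:R^-1 * x ^+ n) @ \oo --> expR x.
  have := is_cvg_series_exp_coeff x; rewrite exp_coeffE => cv.
  by rewrite expRE; exact: cv.
have := DP x (expR x) x01 cx.
set E := \sum_(0 <= i < 9) _ => rho_le; set rho := expR x - E in rho_le.
have eE : expR x - 1 = (E - 1) + rho by rewrite /rho; ring.
have ex : x <= expR x - 1 by have := expR_ge1Dx x; lra.
have e0 : 0 < expR x - 1 by lra.
have D0 : 0 <= D * x ^+ 9 by rewrite (le_trans _ rho_le).
have key : x - bernoulli_poly x * (E - 1) = x ^+ 9 * ((1 - 11 / 14 * x
    - x ^+ 3 / 168 - x ^+ 4 / 294 - x ^+ 5 / (48 * 49)) / (720 * 720)).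
  rewrite /E /bernoulli_poly !big_nat_recr//= big_nil !factS fact0 !natrM.
  by field.
have q_le : `|x - bernoulli_poly x * (E - 1)| <= x ^+ 9.
  rewrite key normrM [`|x ^+ 9|]ger0_norm ?exprn_ge0// ler_piMr ?exprn_ge0//.
  have xi i : 0 <= x ^+ i <= 1 by rewrite exprn_ge0// exprn_ile1.
  have := xi 3%N; have := xi 4%N; have := xi 5%N.
  by rewrite ler_norml => /andP[? ?] /andP[? ?] /andP[? ?]; apply/andP; split; lra.
have T_le : `|bernoulli_poly x| <= 3.
  have xi i : 0 <= x ^+ i <= 1 by rewrite exprn_ge0// exprn_ile1.
  have := xi 2%N; have := xi 4%N; have := xi 6%N; rewrite /bernoulli_poly.
  by rewrite ler_norml => /andP[? ?] /andP[? ?] /andP[? ?]; apply/andP; split; lra.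
have -> : x / (expR x - 1) - bernoulli_poly x
    = (x - bernoulli_poly x * (E - 1) - bernoulli_poly x * rho) / (expR x - 1).
  rewrite (_ : _ - bernoulli_poly x * rho = x - bernoulli_poly x * (expR x - 1)).
    by field; rewrite gt_eqF.
  by rewrite eE; ring.
rewrite normrM normfV [`|expR x - 1|]gtr0_norm// ler_pdivrMr//.
rewrite (le_trans (ler_normB _ _))//.
have Trho : `|bernoulli_poly x * rho| <= 3 * (D * x ^+ 9) by rewrite normrM ler_pM.
have le9 : (1 + 3 * D) * x ^+ 9 <= (1 + 3 * D) * x ^+ 8 * (expR x - 1).
  rewrite -mulrA [X in _ * X <= _]exprSr ler_wpM2l//.
    have D1 : 0 <= D by move: D0; rewrite pmulr_lge0 ?exprn_gt0.
    by lra.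
  by rewrite ler_wpM2l// exprn_ge0// ltW.
by move: q_le Trho le9; lra.
Qed.

End PowerSeries.

(** * Bernoulli numbers *)

Section BernoulliNumbers.
Context {R : realType} (B : nat -> R) (hB : is_bernoulli B).

Lemma two_lt_2pi : 2 < 2 * pi :> R.
Proof. by have := pi_ge2 R; lra. Qed.

(** Since 2 < 2 pi, the Bernoulli series converges at 2, as [power_series_remainder] requires. *)
Lemma bernoulli_remainder m : exists C, forall x : R, 0 < x -> x <= 1 ->
  `|x / (expR x - 1) - \sum_(0 <= i < m) B i / i`!%:R * x ^+ i| <= C * x ^+ m.
Proof.
have cv : cvgn (series (fun n => B n / n`!%:R * (2 : R) ^+ n)).
  apply/cvg_ex; exists (2 / (expR 2 - 1)); apply: hB; first by rewrite pnatr_eq0.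
  by rewrite ger0_norm// two_lt_2pi.
have [C CP] := power_series_remainder _ m cv; exists C => x x0 x1.
apply: CP; first by rewrite x1 ltW.
apply: hB; first by rewrite gt_eqF.
by rewrite gtr0_norm// (le_lt_trans x1)// (lt_trans _ two_lt_2pi)// ltr1n.
Qed.

(** Two polynomials of degree below 8 that approximate x / (e^x - 1) to O(x^8) have equal
    coefficients. The list has seven entries; for i = 7 the default 0 of [nth] is the value. *)
Lemma bernoulli_coefficients i : (i < 8)%N -> B i / i`!%:R =
  nth 0 [:: 1; - (1 / 2); 1 / 12; 0; - (1 / 720); 0; 1 / (720 * 42)] i.
Proof.
pose T (n : nat) : R :=
  nth 0 [:: 1; - (1 / 2); 1 / 12; 0; - (1 / 720); 0; 1 / (720 * 42)] n.
have TE y : \sum_(0 <= n < 8) T n * y ^+ n = bernoulli_poly y.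
  by rewrite /T /bernoulli_poly !big_nat_recr//= big_nil; field.
have [C CP] := bernoulli_remainder 8; have [D DP] := bernoulli_poly_approx (R := R).
move=> i8; apply/eqP; rewrite -subr_eq0; apply/eqP.
apply: (polynomial_small_eq0 8 (fun n => B n / n`!%:R - T n) (C + D)) i8 => y y0 y1.
under eq_bigr do rewrite mulrBl.
rewrite sumrB TE mulrDl; have := CP y y0 y1; have := DP y y0 y1.
set r := y / _; set S := \sum_(0 <= n < 8) _ => h1 h2.
rewrite (_ : S - _ = (r - bernoulli_poly y) - (r - S)); last by ring.
by rewrite (le_trans (ler_normB _ _))// addrC lerD.
Qed.

Lemma bernoulli_partial_sum (x : R) :
  \sum_(0 <= n < 8) B n / n`!%:R * x ^+ n = bernoulli_poly x.
Proof.
rewrite /bernoulli_poly !big_nat_recr//= big_nil !bernoulli_coefficients//=.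
by field.
Qed.

(** As B_3 = 0, the first four terms add up to 1 - x/2 + x^2/12, and removing them from x / (e^x -
    1) leaves minus [kernel_norm_sqr]. *)
Lemma bernoulli_tail_cvg (x : R) : 0 < x -> x <= 1 ->
  (\sum_(4 <= n < m) B n * x ^+ n / n`!%:R) @[m --> \oo] --> - kernel_norm_sqr x.
Proof.
move=> x0 x1.
have head : \sum_(0 <= n < 4) B n / n`!%:R * x ^+ n = 1 - x / 2 + x ^+ 2 / 12.
  by rewrite !big_nat_recr//= big_nil !bernoulli_coefficients//=; field.
rewrite (_ : - kernel_norm_sqr x = x / (expR x - 1) - \sum_(0 <= n < 4) B n / n`!%:R * x ^+ n); last first.
  by rewrite head /kernel_norm_sqr; ring.
have sx : series (fun n => B n / n`!%:R * x ^+ n) @ \oo --> x / (expR x - 1).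
  apply: hB; first by rewrite gt_eqF.
  by rewrite gtr0_norm// (le_lt_trans x1)// (lt_trans _ two_lt_2pi)// ltr1n.
apply: cvg_trans (cvgB sx (cvg_cst (\sum_(0 <= n < 4) B n / n`!%:R * x ^+ n))).
apply: near_eq_cvg; exists 4%N => // m /= m4.
rewrite /series/= !fctE (big_cat_nat (leq0n 4) m4)/= [_ + \sum_(4 <= _ < _) _]addrC addrK.
by apply: eq_bigr => n _; rewrite mulrAC.
Qed.

End BernoulliNumbers.

(** * The norm as a Bernoulli tail and its asymptotic expansion *)

Lemma natr30240 (R : realType) : 30240%:R = 720 * 42 :> R.
Proof.
by rewrite -natrM.
Qed.

Theorem theorem4 (R : realType) (B : nat -> R) (hB : is_bernoulli B) :
  (forall N : nat, (1 <= N)%N ->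
     cvgn (fun m => \sum_(4 <= n < m) B n * mesh N ^+ n / n`!%:R) /\
     (W2_dual_norm (error_functional N) ^+ 2)%E
     = (- limn (fun m => \sum_(4 <= n < m) B n * mesh N ^+ n / n`!%:R))%:E) /\
  (fun N : nat => fine (W2_dual_norm (R := R) (error_functional N)) ^+ 2)
  = (fun N : nat => 1 / 720%:R * mesh N ^+ 4 - 1 / 30240%:R * mesh N ^+ 6)
    +O_\oo (fun N : nat => (mesh N : R) ^+ 8).
Proof.
have mesh_le1 N : (0 < N)%N -> mesh N <= 1 :> R.
  by move=> N0; rewrite /mesh ler_pdivrMr ?ltr0n// mul1r ler1n.
have norm_sq N : (0 < N)%N -> Num.sqrt (kernel_norm_sqr (mesh N)) ^+ 2 = kernel_norm_sqr (mesh N) :> R.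
  by move=> N0; rewrite sqr_sqrtr// kernel_norm_sqr_ge0.
split=> [N N0|].
  have tail := bernoulli_tail_cvg B hB _ (mesh_gt0 N N0) (mesh_le1 N N0).
  split; first by apply/cvg_ex; eexists; exact: tail.
  rewrite W2_dual_norm_error// -EFin_expe norm_sq//; congr EFin.
  by rewrite (cvg_lim _ tail)// opprK.
have [C CP] := bernoulli_remainder B hB 8.
apply/eqaddOP; exists C; split; first exact: num_real.
(* Only large N matter, which excludes N = 0, where [mesh] divides by zero. *)
move=> k Ck; exists 1%N => // N /= N0.
have h0 : 0 < mesh N :> R := mesh_gt0 N N0.
have := CP _ h0 (mesh_le1 N N0).
rewrite bernoulli_partial_sum// !fctE W2_dual_norm_error//= norm_sq//.
set r := mesh N / (expR (mesh N) - 1) => le.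
rewrite [`|mesh N ^+ 8|]ger0_norm ?exprn_ge0 ?(ltW h0)//.
(* The squared norm is 1 - h/2 + h^2/12 - r; subtracting the h^4 and h^6 terms completes the
   polynomial part to [bernoulli_poly]. *)
rewrite natr30240 (_ : _ - _ = - (r - bernoulli_poly (mesh N))).
  by rewrite normrN (le_trans le)// ler_wpM2r ?exprn_ge0 ?(ltW h0)// ltW.
by rewrite /kernel_norm_sqr -/r /bernoulli_poly; field.
Qed.
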